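(* Let $n=3$ and $\varphi(x)=\max\{x_1,x_2,x_3\}$. The unique viscosity solution $u:\mathbb{R}^3\to\mathbb{R}$ of at most linear growth of $$u(x)=\varphi(x)+\tfrac12\max_{v\in\{0,1\}^3}\langle D^2u(x)\, v,v\rangle,\qquad x\in\mathbb{R}^3,$$ is symmetric with respect to $x_1,x_2,x_3$, and in the region $x_1\ge x_2\ge x_3$ it is given by $$u(x)=x_1+\frac{1}{2\sqrt2}e^{\sqrt2(x_2-x_1)}+\frac{1}{6\sqrt2}e^{\sqrt2(2x_3-x_2-x_1)}.$$
   Context: Viscosity solution: a continuous function $u$ such that for every $x_0$ and smooth $\psi$, if $u-\psi$ has a local minimum (resp. maximum) at $x_0$, then $u(x_0)-\varphi(x_0)-\frac12\max_{v\in\{0,1\}^3}\langle D^2\psi(x_0)v,v\rangle\ge0$ (resp. $\le0$). It is known that the equation has a unique viscosity solution among functions of at most linear growth at infinity. *)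

(* Defs.v *)
From HB Require Import structures.
From mathcomp Require Import all_boot all_order all_algebra all_fingroup.
From mathcomp Require Import all_classical all_reals all_analysis.

Set Implicit Arguments.
Unset Strict Implicit.
Unset Printing Implicit Defensive.

Import Order.TTheory GRing.Theory Num.Theory.
Import numFieldNormedType.Exports.

Local Open Scope classical_set_scope.
Local Open Scope ring_scope.

(* Points of R^n are row vectors; coordinates are indexed from 0, so that
   [x 0 0], [x 0 1], [x 0 2] are the first, second and third coordinates. *)

Definition partial (R : realType) (n : nat) (i : 'I_n) (f : 'rV[R]_n -> R) :
    'rV[R]_n -> R :=
  fun x => 'D_(delta_mx 0 i) f x.

Fixpoint Ck (R : realType) (n k : nat) (f : 'rV[R]_n -> R) : Prop :=
  match k with
  | 0 => continuous f
  | k'.+1 => continuous f /\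
      forall i : 'I_n,
        (forall x, derivable f x (delta_mx 0 i)) /\ Ck k' (partial i f)
  end.

Definition smooth (R : realType) (n : nat) (f : 'rV[R]_n -> R) : Prop :=
  forall k, Ck k f.

Definition hessian (R : realType) (n : nat) (f : 'rV[R]_n -> R)
    (x : 'rV[R]_n) : 'M[R]_n :=
  \matrix_(i, j) partial j (partial i f) x.

(* <A v, v>, with v written as a row. *)
Definition qform (R : realType) (n : nat) (A : 'M[R]_n) (v : 'rV[R]_n) : R :=
  (v *m A *m v^T) 0 0.

Definition cube_vec (R : realType) (n : nat) (b : {ffun 'I_n -> bool}) :
    'rV[R]_n :=
  \row_i (b i)%:R.

(* The maximum of <A v, v> over v in {0,1}^n.  The iterated maximum needs a
   default value; v = 0 belongs to {0,1}^n, so its value is a neutral choice. *)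
Definition max_cube (R : realType) (n : nat) (A : 'M[R]_n) : R :=
  \big[Num.max/qform A 0]_(b : {ffun 'I_n -> bool}) qform A (cube_vec R b).

Definition local_min (R : realType) (n : nat) (f : 'rV[R]_n -> R)
    (x0 : 'rV[R]_n) : Prop :=
  \forall x \near x0, f x0 <= f x.

Definition local_max (R : realType) (n : nat) (f : 'rV[R]_n -> R)
    (x0 : 'rV[R]_n) : Prop :=
  \forall x \near x0, f x <= f x0.

(* Viscosity solutions of u = phi + (1/2) max_{v in {0,1}^n} <D^2u v, v>. *)
Definition viscosity_solution (R : realType) (n : nat) (phi u : 'rV[R]_n -> R) :
    Prop :=
  continuous u /\
  forall (x0 : 'rV[R]_n) (psi : 'rV[R]_n -> R), smooth psi ->
    (local_min (fun x => u x - psi x) x0 ->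
       0 <= u x0 - phi x0 - 2^-1 * max_cube (hessian psi x0)) /\
    (local_max (fun x => u x - psi x) x0 ->
       u x0 - phi x0 - 2^-1 * max_cube (hessian psi x0) <= 0).

(* [`|x|] is the sup norm on 'rV[R]_n; since all norms on R^n are equivalent,
   the condition does not depend on this choice. *)
Definition linear_growth (R : realType) (n : nat) (u : 'rV[R]_n -> R) : Prop :=
  exists C : R, forall x : 'rV[R]_n, `|u x| <= C * (1 + `|x|).

Definition max3 (R : realType) (x : 'rV[R]_3) : R :=
  Num.max (Num.max (x 0 0) (x 0 1)) (x 0 2).

Definition symmetric_fun (R : realType) (n : nat) (u : 'rV[R]_n -> R) : Prop :=
  forall (s : 'S_n) (x : 'rV[R]_n), u (col_perm s x) = u x.

(* Main.v *)
(* Let U be the function given by the formula in the ordered chamber and extended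
   symmetrically.  It has a second-order Taylor expansion at every point, the
   expansions of adjacent chambers agreeing on their common wall, and its Hessian
   satisfies the equation, the maximum being attained at the basis vector of the
   largest coordinate.  If psi touches U at x0, the second-derivative test along
   each v compares D^2 psi with D^2 U on v, so U is a viscosity solution.
   Conversely, let u be a viscosity solution with u - U of linear growth and let
   x0 maximize s (u - U) - d |x|^2, where s = 1 or s = -1.  The second-order
   Taylor polynomial of U at x0, perturbed by s (e |x - x0|^2 + d |x|^2), is a
   quadratic test function for u at x0, and the equation yields
   s (u - U)(x0) <= 3 (e + d); then e and d tend to 0. *)

Require Import Defs.
From mathcomp Require Import all_boot all_order all_algebra all_fingroup.
From mathcomp Require Import all_classical all_reals all_analysis.
From mathcomp Require Import ring lra.

Set Implicit Arguments.
Unset Strict Implicit.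
Unset Printing Implicit Defensive.

Import Order.TTheory GRing.Theory Num.Theory.
Import numFieldNormedType.Exports.
Local Open Scope classical_set_scope.
Local Open Scope ring_scope.

(** * Directional derivatives and one-variable calculus *)

(** Multiplying the difference quotient through by [h] removes the division. The resulting bound is
    trivial at [h = 0], so the punctured neighbourhood becomes a plain one. *)
Lemma is_derive_epsP (R : realType) (V : normedModType R) (f : V -> R)
    (x v : V) (l : R) :
  is_derive x v f l <->
  forall e : R, 0 < e -> exists2 d : R, 0 < d &
    forall h : R, `|h| < d -> `|f (h *: v + x) - f x - h * l| <= e * `|h|.
Proof.
have quot (h : R) : h != 0 ->
  l - h^-1 *: (f (h *: v + x) - f x) = - h^-1 * (f (h *: v + x) - f x - h * l).
  by move=> h0; rewrite /GRing.scale /= mulNr [in RHS]mulrBr mulKf// opprB.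
have limP : ((fun h => h^-1 *: ((f \o shift x) (h *: v) - f x)) @ 0^' --> l)%classic <->
  forall e : R, 0 < e -> exists2 d : R, 0 < d &
    forall h : R, `|h| < d -> `|f (h *: v + x) - f x - h * l| <= e * `|h|.
  split=> [/cvgrPdist_le H e e0|H].
    have /= := H e e0.
    rewrite /dnbhs near_withinE => /nbhs_ballP[d /= d0 Hd].
    exists d => // h hd; have [->|h0] := eqVneq h 0.
      by rewrite scale0r add0r subrr mul0r subrr normr0 mulr0.
    have /= := Hd h; rewrite /ball/= sub0r normrN => /(_ hd h0).
    rewrite quot// normrM normrN normfV mulrC ler_pdivrMr ?normr_gt0//.
  apply/cvgrPdist_le => e e0 /=; have [d d0 Hd] := H e e0.
  rewrite /dnbhs near_withinE; apply/nbhs_ballP; exists d => //= h.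
  rewrite /ball/= sub0r normrN => hd h0.
  by rewrite quot// normrM normrN normfV mulrC ler_pdivrMr ?normr_gt0//; exact: Hd.
split=> [[df dfl]|/limP H]; first by apply/limP; rewrite -dfl.
by split; [apply/cvg_ex; exists l|exact: cvg_lim].
Qed.

(** The remainder h^2 q is at most e |h| once |h| < e / (1 + |q|). Derivatives of affine and
    quadratic functions thus reduce to an algebraic expansion. *)
Lemma is_derive_second_order (R : realType) (V : normedModType R) (f : V -> R)
    (x v : V) (l q : R) :
  (forall h : R, f (h *: v + x) = f x + h * l + h ^+ 2 * q) -> is_derive x v f l.
Proof.
move=> H; apply/is_derive_epsP => e e0.
exists (e / (1 + `|q|)) => [|h hd].
  by rewrite divr_gt0// ltr_pwDl.
rewrite H (_ : _ - _ = h ^+ 2 * q); last by ring.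
rewrite normrM normrX expr2 mulrAC ler_wpM2r//.
have /ltW: `|h| * (1 + `|q|) < e by rewrite -ltr_pdivlMr// ltr_pwDl.
apply: le_trans; rewrite ler_wpM2l// lerDr//.
Qed.

Lemma is_derive_line (R : realType) (V : normedModType R) (f : V -> R)
    (x v : V) (t l : R) :
  is_derive (t *: v + x) v f l -> is_derive t 1 (fun s : R => f (s *: v + x)) l.
Proof.
move=> /is_derive_epsP H; apply/is_derive_epsP => e e0.
have [d d0 Hd] := H e e0; exists d => // h /Hd.
by rewrite [h *: 1]mulr1 scalerDl addrA.
Qed.

Lemma MVT_norm_le (R : realType) (g dg : R -> R) (M t : R) :
  (forall s : R, `|s| <= `|t| -> is_derive s 1 g (dg s)) ->
  (forall s : R, `|s| <= `|t| -> `|dg s| <= M) ->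
  `|g t - g 0| <= M * `|t|.
Proof.
move=> Hd Hb.
have cont (a b : R) : (forall s, a <= s <= b -> is_derive s 1 g (dg s)) ->
   {within `[a, b]%classic, continuous g}.
  move=> H; apply: derivable_within_continuous => s.
  by rewrite in_itv /= => sab; have [] := H s sab.
have [t0|t0] := leP 0 t.
- have in_t s : 0 <= s <= t -> `|s| <= `|t|.
    by move=> /andP[s0 st]; rewrite !ger0_norm.
  have [|c|c ct ->] := @MVT_segment R g dg 0 t t0.
  + move=> s; rewrite in_itv /= => /andP[s0 st].
    by apply/Hd/in_t; rewrite !ltW.
  + by apply: cont => s st; apply/Hd/in_t.
  rewrite subr0 normrM ler_wpM2r//; apply/Hb/in_t.
  by move: ct; rewrite in_itv.
- have in_t s : t <= s <= 0 -> `|s| <= `|t|.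
    by move=> /andP[s0 st]; rewrite !ler0_norm ?lerN2// ltW.
  have [|c|c ct] := @MVT_segment R g dg t 0 (ltW t0).
  + move=> s; rewrite in_itv /= => /andP[s0 st].
    by apply/Hd/in_t; rewrite !ltW.
  + by apply: cont => s st; apply/Hd/in_t.
  rewrite distrC => ->.
  rewrite sub0r normrM normrN ler_wpM2r//; apply/Hb/in_t.
  by move: ct; rewrite in_itv.
Qed.

(** The displacement h (v + w) is made in two legs, first h v and then h w. Differentiability at [x]
    controls the first leg; continuity of [fw] at [x] and the mean value inequality control the
    second. *)
Lemma is_deriveDdir (R : realType) (V : normedModType R) (f fv fw : V -> R)
    (v w : V) :
  (forall x, is_derive x v f (fv x)) -> (forall x, is_derive x w f (fw x)) ->
  continuous fw -> forall x, is_derive x (v + w) f (fv x + fw x).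
Proof.
move=> dv dw cw x; apply/is_derive_epsP => e e0.
have e20 : 0 < e / 2 by rewrite divr_gt0.
have [d1 d10 H1] := (is_derive_epsP _ _ _ _).1 (dv x) _ e20.
have /cvgrPdist_le/(_ _ e20)/nbhs_normP[r /= r0 Hr] := cw x.
(* Points [s *: w + (h *: v + x)] with |s| <= |h| stay within |h| M of [x]; the summand 1 makes [M]
   positive. *)
pose M := `|v| + `|w| + 1.
have M0 : 0 < M by rewrite ltr_wpDl// addr_ge0.
exists (Num.min d1 (r / M)) => [|h]; first by rewrite lt_min d10 divr_gt0.
rewrite lt_min => /andP[hd1 hr].
have K : `|h| * M < r by rewrite -ltr_pdivlMr.
pose g s := f (s *: w + (h *: v + x)) - s * fw x.
have -> : f (h *: (v + w) + x) - f x - h * (fv x + fw x)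
   = (g h - g 0) + (f (h *: v + x) - f x - h * fv x).
  rewrite (_ : h *: (v + w) + x = h *: w + (h *: v + x)); last first.
    by rewrite scalerDr addrA [h *: v + _]addrC.
  by rewrite /g scale0r add0r; ring.
apply: le_trans (ler_normD _ _) _.
rewrite [e in leRHS]splitr mulrDl; apply: lerD; last exact: H1.
apply: (@MVT_norm_le _ g (fun s => fw (s *: w + (h *: v + x)) - fw x)) => s sh.
  apply: is_deriveB.
    exact: is_derive_line (dw _).
  apply: (@is_derive_second_order _ _ _ _ _ _ 0) => k.
  by rewrite /GRing.scale/=; ring.
rewrite distrC; apply: Hr; rewrite /ball_ /=.
rewrite addrA opprD addrCA subrr addr0 normrN.
apply: le_lt_trans (ler_normD _ _) _; rewrite !normrZ.
apply: le_lt_trans K; rewrite /M.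
have := normr_ge0 v; have := normr_ge0 w; have := normr_ge0 h; nra.
Qed.

(** If l < 0, the even function g u + g (- u) has derivative dg u - dg (- u), close to 2 u l and
    hence negative for small u > 0. The mean value theorem then contradicts minimality at 0. *)
Lemma second_derivative_test (R : realType) (g dg : R -> R) (r l : R) :
  0 < r ->
  (forall s : R, `|s| < r -> is_derive s 1 g (dg s)) ->
  is_derive (0 : R) 1 dg l -> (forall s : R, `|s| < r -> g 0 <= g s) -> 0 <= l.
Proof.
move=> r0 dgP /is_derive_epsP ddg gmin; rewrite leNgt; apply/negP => l0.
(* With this tolerance the errors at c and - c add up to - c l, leaving dg c - dg (- c) <= c l <
   0. *)
have e0 : 0 < - l / 2 by rewrite divr_gt0// oppr_gt0.
have [d d0 Hd] := ddg _ e0.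
pose t := Num.min d r / 2.
have m0 : 0 < Num.min d r by rewrite lt_min d0.
have t0 : 0 < t by rewrite divr_gt0.
have /andP[td tr] : (t < d) && (t < r).
  by rewrite -lt_min /t ltr_pdivrMr// ltr_pMr// ltr1n.
(* the first-order term cancels in the symmetric difference *)
pose s u := g u + g (- u).
have sP (u : R) : `|u| <= `|t| -> is_derive u 1 s (dg u - dg (- u)).
  rewrite (gtr0_norm t0) => ut.
  have ur : `|u| < r by apply: le_lt_trans tr.
  apply: is_deriveD; first exact: dgP.
  have /is_derive_epsP H : is_derive (- u) 1 g (dg (- u)) by apply: dgP; rewrite normrN.
  apply/is_derive_epsP => e e0'; have [k k0 Hk] := H e e0'.
  exists k => // h hk; have := Hk (- h); rewrite normrN => /(_ hk).
  rewrite (_ : - h *: 1 + - u = - (h *: 1 + u)); last by rewrite opprD scaleNr.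
  by rewrite mulNr mulrN.
have [||c] := @MVT R s (fun u => dg u - dg (- u)) 0 t t0.
- move=> u; rewrite in_itv /= => /andP[u0 ut]; apply: sP.
  by rewrite !gtr0_norm// ltW.
- apply: derivable_within_continuous => u; rewrite in_itv /= => /andP[u0 ut].
  by have [] : is_derive u 1 s (dg u - dg (- u)) by apply: sP; rewrite !ger0_norm// ltW.
rewrite in_itv /= => /andP[c0 ct] E.
have gt : g 0 <= g t by apply: gmin; rewrite gtr0_norm.
have gNt : g 0 <= g (- t) by apply: gmin; rewrite normrN gtr0_norm.
have cd : `|c| < d by rewrite gtr0_norm// (lt_trans ct).
have := Hd c cd; have := Hd (- c); rewrite normrN => /(_ cd).
rewrite /GRing.scale /= !mulr1 !addr0 (gtr0_norm c0) !ler_norml.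
move: E; rewrite /s oppr0 addr0.
move=> E /andP[A1 A2] /andP[B1 B2].
have : 0 <= (dg c - dg (- c)) * t by rewrite -E; lra.
rewrite pmulr_lge0//; have : c * l < 0 by rewrite pmulr_rlt0.
lra.
Qed.

(** * Bilinear forms and quadratic test functions *)

(** The polarised form of [qform]: [bilin A v v] is convertible to [qform A v], and the proofs
    switch between the two by conversion. [bilin 1%:M] serves as the scalar product. *)
Definition bilin (R : realType) (n : nat) (A : 'M[R]_n) (u v : 'rV[R]_n) : R :=
  (u *m A *m v^T) 0 0.

Lemma bilinDl (R : realType) (n : nat) (A : 'M[R]_n) (u v w : 'rV[R]_n) :
  bilin A (u + v) w = bilin A u w + bilin A v w.
Proof. by rewrite /bilin !mulmxDl mxE. Qed.

Lemma bilinDr (R : realType) (n : nat) (A : 'M[R]_n) (u v w : 'rV[R]_n) :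
  bilin A u (v + w) = bilin A u v + bilin A u w.
Proof. by rewrite /bilin linearD /= mulmxDr mxE. Qed.

Lemma bilinZl (R : realType) (n : nat) (A : 'M[R]_n) (a : R) (u v : 'rV[R]_n) :
  bilin A (a *: u) v = a * bilin A u v.
Proof. by rewrite /bilin -!scalemxAl mxE. Qed.

Lemma bilinZr (R : realType) (n : nat) (A : 'M[R]_n) (a : R) (u v : 'rV[R]_n) :
  bilin A u (a *: v) = a * bilin A u v.
Proof. by rewrite /bilin linearZ /= -scalemxAr mxE. Qed.

Lemma bilinDm (R : realType) (n : nat) (A B : 'M[R]_n) (u v : 'rV[R]_n) :
  bilin (A + B) u v = bilin A u v + bilin B u v.
Proof. by rewrite /bilin mulmxDr mulmxDl mxE. Qed.

Lemma bilinZm (R : realType) (n : nat) (a : R) (A : 'M[R]_n) (u v : 'rV[R]_n) :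
  bilin (a *: A) u v = a * bilin A u v.
Proof. by rewrite /bilin -scalemxAr -scalemxAl mxE. Qed.

Lemma bilin_tr (R : realType) (n : nat) (A : 'M[R]_n) (u v : 'rV[R]_n) :
  bilin A^T u v = bilin A v u.
Proof.
rewrite /bilin -[in RHS](trmxK (v *m A *m u^T)) [in RHS]mxE.
by rewrite !trmx_mul trmxK mulmxA.
Qed.

Lemma bilinE (R : realType) (n : nat) (A : 'M[R]_n) (u v : 'rV[R]_n) :
  bilin A u v = \sum_i u 0 i * \sum_j v 0 j * A i j.
Proof.
rewrite /bilin -mulmxA mxE; apply: eq_bigr => i _; congr (_ * _).
by rewrite mxE; apply: eq_bigr => j _; rewrite mxE mulrC.
Qed.

Lemma bilin_delta (R : realType) (n : nat) (A : 'M[R]_n) (i j : 'I_n) :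
  bilin A (delta_mx 0 i) (delta_mx 0 j) = A i j.
Proof.
rewrite bilinE (bigD1 i)//= [X in _ + X]big1 => [|k ki]; last first.
  by rewrite mxE (negPf ki) andbF mul0r.
rewrite addr0 (bigD1 j)//= [X in _ + X]big1 => [|k kj]; last first.
  by rewrite mxE (negPf kj) andbF mul0r.
by rewrite !mxE !eqxx !mul1r addr0.
Qed.

Lemma bilin1E (R : realType) (n : nat) (u v : 'rV[R]_n) :
  bilin 1%:M u v = \sum_i u 0 i * v 0 i.
Proof.
rewrite bilinE; apply: eq_bigr => i _; congr (_ * _).
rewrite (bigD1 i)//= [X in _ + X]big1 => [|k ki]; first by rewrite mxE eqxx mulr1 addr0.
by rewrite mxE eq_sym (negPf ki) mulr0.
Qed.

Lemma continuous_bilin (R : realType) (n : nat) (A : 'M[R]_n)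
    (T : topologicalType) (f g : T -> 'rV[R]_n) :
  continuous f -> continuous g -> continuous (fun x => bilin A (f x) (g x)).
Proof.
move=> cf cg.
have cc (h : T -> 'rV[R]_n) i : continuous h -> continuous (fun x => h x 0 i : R).
  move=> ch x.
  apply: (@continuous_comp _ _ _ h (fun M : 'rV[R]_n => M 0 i) x (ch x)).
  exact: coord_continuous.
under eq_fun do rewrite bilinE.
apply: continuous_big => [|i _ x]; first exact: add_continuous.
apply: continuousM; first exact: cc.
apply: (continuous_big (op := +%R)) x => [|j _ x]; first exact: add_continuous.
by apply: continuousM; [exact: cc|exact: cst_continuous].
Qed.

Definition quadratic (R : realType) (n : nat) (p : 'rV[R]_n) (A : 'M[R]_n)
    (x0 x : 'rV[R]_n) : R :=
  bilin 1%:M p (x - x0) + 2^-1 * bilin A (x - x0) (x - x0).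

(** The derivative of [quadratic] at [x] in the direction [v]. Both orders of the arguments occur
    because [A] may be nonsymmetric. *)
Definition quadratic_grad (R : realType) (n : nat) (p : 'rV[R]_n) (A : 'M[R]_n)
    (x0 v x : 'rV[R]_n) : R :=
  bilin 1%:M p v + 2^-1 * (bilin A (x - x0) v + bilin A v (x - x0)).

Lemma quadratic_line (R : realType) (n : nat) (p : 'rV[R]_n) (A : 'M[R]_n)
    (x0 x v : 'rV[R]_n) (h : R) :
  quadratic p A x0 (h *: v + x) =
  quadratic p A x0 x + h * quadratic_grad p A x0 v x + h ^+ 2 * (2^-1 * bilin A v v).
Proof.
rewrite /quadratic /quadratic_grad -addrA.
rewrite !(bilinDl, bilinDr, bilinZl, bilinZr); ring.
Qed.

Lemma quadratic_grad_line (R : realType) (n : nat) (p : 'rV[R]_n) (A : 'M[R]_n)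
    (x0 x v w : 'rV[R]_n) (h : R) :
  quadratic_grad p A x0 v (h *: w + x) =
  quadratic_grad p A x0 v x + h * (2^-1 * (bilin A w v + bilin A v w)).
Proof.
rewrite /quadratic_grad -addrA.
rewrite !(bilinDl, bilinDr, bilinZl, bilinZr); ring.
Qed.

Lemma is_derive_quadratic_grad (R : realType) (n : nat) (p : 'rV[R]_n)
    (A : 'M[R]_n) (x0 v w x : 'rV[R]_n) :
  is_derive x w (quadratic_grad p A x0 v) (2^-1 * (bilin A w v + bilin A v w)).
Proof.
apply: (@is_derive_second_order _ _ _ _ _ _ 0) => h.
by rewrite quadratic_grad_line mulr0 addr0.
Qed.

Lemma continuous_quadratic (R : realType) (n : nat) (p : 'rV[R]_n) (A : 'M[R]_n)
    (x0 : 'rV[R]_n) : continuous (quadratic p A x0).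
Proof.
have cB : continuous (fun x : 'rV[R]_n => x - x0).
  by move=> x; apply: continuousB; [exact: id|exact: cst_continuous].
have c1 : continuous (fun x : 'rV[R]_n => bilin 1%:M p (x - x0)).
  by apply: continuous_bilin => //; exact: cst_continuous.
have c2 : continuous (fun x : 'rV[R]_n => bilin A (x - x0) (x - x0)).
  exact: continuous_bilin.
move=> x; apply: (continuousD (c1 x)); apply: (@continuousM _ _ (cst 2^-1)).
  exact: cst_continuous.
exact: c2.
Qed.

Lemma continuous_quadratic_grad (R : realType) (n : nat) (p : 'rV[R]_n)
    (A : 'M[R]_n) (x0 v : 'rV[R]_n) : continuous (quadratic_grad p A x0 v).
Proof.
have cB : continuous (fun x : 'rV[R]_n => x - x0).
  by move=> x; apply: continuousB; [exact: id|exact: cst_continuous].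
have c1 : continuous (fun x : 'rV[R]_n => bilin A (x - x0) v).
  by apply: continuous_bilin => //; exact: cst_continuous.
have c2 : continuous (fun x : 'rV[R]_n => bilin A v (x - x0)).
  by apply: continuous_bilin => //; exact: cst_continuous.
have c3 : continuous (fun x : 'rV[R]_n => 2^-1 * (bilin A (x - x0) v + bilin A v (x - x0))).
  have c4 : continuous (fun x : 'rV[R]_n => bilin A (x - x0) v + bilin A v (x - x0)).
    by move=> x; exact: (continuousD (c1 x) (c2 x)).
  by move=> x; apply: continuousM (c4 x); exact: cst_continuous.
have c0 : continuous (cst (bilin 1%:M p v) : 'rV[R]_n -> R) by exact: cst_continuous.
by move=> x; exact: (continuousD (c0 x) (c3 x)).
Qed.

(** The partial derivatives are constants, hence again affine with zero slopes, so the induction on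
    [k] closes. It applies to the gradient of a quadratic function. *)
Lemma Ck_affine (R : realType) (n k : nat) (f : 'rV[R]_n -> R)
    (l : 'I_n -> R) :
  continuous f ->
  (forall i x (h : R), f (h *: delta_mx 0 i + x) = f x + h * l i) -> Ck k f.
Proof.
elim: k f l => [//|k IH] f l cf fl; split => // i.
have df x : is_derive x (delta_mx 0 i) f (l i).
  by apply: (@is_derive_second_order _ _ _ _ _ _ 0) => h; rewrite fl mulr0 addr0.
split=> [x|]; first by have [] := df x.
have -> : partial i f = fun=> l i by apply/funext => x; have [] := df x.
apply: (IH _ (fun=> 0)) => [|j x h]; first exact: cst_continuous.
by rewrite mulr0 addr0.
Qed.

Lemma partial_quadratic (R : realType) (n : nat) (p : 'rV[R]_n) (A : 'M[R]_n)
    (x0 : 'rV[R]_n) (i : 'I_n) :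
  partial i (quadratic p A x0) = quadratic_grad p A x0 (delta_mx 0 i).
Proof.
apply/funext => x.
by have [] := is_derive_second_order (quadratic_line p A x0 x (delta_mx 0 i)).
Qed.

Lemma smooth_quadratic (R : realType) (n : nat) (p : 'rV[R]_n) (A : 'M[R]_n)
    (x0 : 'rV[R]_n) : smooth (quadratic p A x0).
Proof.
case=> [|k]; first exact: continuous_quadratic.
split=> [|i]; first exact: continuous_quadratic.
split=> [x|].
  by have [] := is_derive_second_order (quadratic_line p A x0 x (delta_mx 0 i)).
rewrite partial_quadratic.
apply: Ck_affine => [|j x h]; first exact: continuous_quadratic_grad.
exact: quadratic_grad_line.
Qed.

Lemma hessian_quadratic (R : realType) (n : nat) (p : 'rV[R]_n) (A : 'M[R]_n)
    (x0 x : 'rV[R]_n) :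
  hessian (quadratic p A x0) x = 2^-1 *: (A + A^T).
Proof.
apply/matrixP => i j; rewrite !mxE partial_quadratic.
have [_] := is_derive_quadratic_grad p A x0 (delta_mx 0 i) (delta_mx 0 j) x.
by rewrite /partial => ->; rewrite !bilin_delta addrC.
Qed.

Lemma qform_hessian_quadratic (R : realType) (n : nat) (p : 'rV[R]_n)
    (A : 'M[R]_n) (x0 x v : 'rV[R]_n) :
  qform (hessian (quadratic p A x0) x) v = bilin A v v.
Proof.
rewrite hessian_quadratic -[LHS]/(bilin _ v v) bilinZm bilinDm bilin_tr; lra.
Qed.

(** * Directional derivatives of C^1 and C^2 functions *)

(** [v] is decomposed along the basis and the coordinate directions are added one at a time by
    [is_deriveDdir], using continuity of the partial derivatives. *)
Lemma is_derive_C1 (R : realType) (n : nat) (f : 'rV[R]_n -> R)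
    (v x : 'rV[R]_n) :
  Ck 1 f -> is_derive x v f (\sum_i v 0 i * partial i f x).
Proof.
move=> [_ Hf]; rewrite {1}[v]row_sum_delta.
have dZ (i : 'I_n) (y : 'rV[R]_n) :
    is_derive y (v 0 i *: delta_mx 0 i) f (v 0 i * partial i f y).
  apply/is_derive_epsP => e e0.
  have /derivableP/is_derive_epsP Hd := (Hf i).1 y.
  (* Moving by h along v_i e_i is moving by h v_i along e_i, so tolerance and radius are both
     divided by |v_i| + 1, which is positive even if v_i = 0. *)
  have c0 : 0 < `|v 0 i| + 1 by rewrite ltr_wpDl.
  have [d d0 H] := Hd _ (divr_gt0 e0 c0).
  exists (d / (`|v 0 i| + 1)) => [|h]; first exact: divr_gt0.
  rewrite ltr_pdivlMr// => hd.
  have := H (h * v 0 i); rewrite -scalerA -mulrA => /(_ _)/le_trans; apply.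
    by rewrite normrM (le_lt_trans _ hd)// ler_wpM2l// lerDl.
  rewrite normrM [leRHS]mulrC mulrCA ler_wpM2l// mulrAC ler_pdivrMr//.
  by rewrite ler_wpM2l ?(ltW e0)// lerDl.
elim: (index_enum 'I_n) x => [|i r IH] x.
  by rewrite !big_nil; exact: is_derive0.
(* The head of the list is moved last: [is_deriveDdir] asks for a continuous derivative in its
   second direction. *)
rewrite !big_cons [_ *: _ + _]addrC [_ * _ + _]addrC.
apply: (is_deriveDdir (fv := fun y => \sum_(j <- r) v 0 j * partial j f y)
  (fw := fun y => v 0 i * partial i f y)) => // y.
by apply: continuousM; [exact: cst_continuous|have [_] := Hf i; exact].
Qed.

Lemma is_derive_C2 (R : realType) (n : nat) (f : 'rV[R]_n -> R)
    (v x : 'rV[R]_n) : Ck 2 f ->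
  is_derive x v (fun y => \sum_i v 0 i * partial i f y) (qform (hessian f x) v).
Proof.
move=> [_ Hf].
have -> : qform (hessian f x) v =
    \sum_i v 0 i *: \sum_j v 0 j * partial j (partial i f) x.
  rewrite -[LHS]/(bilin _ v v) bilinE; apply: eq_bigr => i _; congr (_ * _).
  by apply: eq_bigr => j _; rewrite mxE.
have -> : (fun y => \sum_i v 0 i * partial i f y) = \sum_i (v 0 i \*: partial i f).
  by apply/funext => y; rewrite fct_sumE.
apply: is_derive_sum => i; apply: is_deriveZ.
exact/is_derive_C1/(Hf i).2.
Qed.

(** * Second-order expansions and contact with test functions *)

(** The remainder is measured by the squared Euclidean norm rather than the sup norm, so that it is
    itself a quadratic form and can be absorbed into a quadratic test function. *)
Definition jet2 (R : realType) (n : nat) (f : 'rV[R]_n -> R)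
    (x0 p : 'rV[R]_n) (A : 'M[R]_n) : Prop :=
  forall e : R, 0 < e -> \forall x \near x0,
    `|f x - f x0 - quadratic p A x0 x| <= e * qform 1%:M (x - x0).

Lemma qform1_ge0 (R : realType) (n : nat) (x : 'rV[R]_n) : 0 <= qform 1%:M x.
Proof.
rewrite -[qform _ _]/(bilin _ x x) bilin1E.
by apply: sumr_ge0 => i _; rewrite -expr2 sqr_ge0.
Qed.

Lemma norm_coord_le (R : realType) (n : nat) (x : 'rV[R]_n) (i : 'I_n) :
  `|x 0 i| <= `|x|.
Proof.
rewrite [leRHS]/Num.norm /= mx_normrE.
exact: (le_bigmax _ (fun ij => `|x ij.1 ij.2|) (0, i)).
Qed.

Lemma sqr_norm_le_qform1 (R : realType) (n : nat) (x : 'rV[R]_n) :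
  `|x| ^+ 2 <= qform 1%:M x.
Proof.
have [/eqP|x0] := eqVneq `|x| 0.
  by move=> /eqP ->; rewrite expr0n/= qform1_ge0.
have [[i j] /= xij] := mx_norm_neq0 x0.
rewrite [`|x|]xij (ord1 i) -[qform _ _]/(bilin _ x x) bilin1E (bigD1 j)//=.
rewrite real_normK ?num_real// -expr2 lerDl.
by apply: sumr_ge0 => k _; rewrite -expr2 sqr_ge0.
Qed.

Lemma qform1_cube_le (R : realType) (n : nat) (b : {ffun 'I_n -> bool}) :
  qform 1%:M (cube_vec R b) <= n%:R.
Proof.
rewrite -[qform _ _]/(bilin _ (cube_vec R b) (cube_vec R b)) bilin1E.
apply: (@le_trans _ _ (\sum_(i < n) (1 : R))).
  apply: ler_sum => i _; rewrite mxE; case: (b i); first by rewrite mulr1.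
  by rewrite mulr0 ler01.
by rewrite sumr_const card_ord.
Qed.

(** The default value [qform A 0] of the iterated maximum is 0; it is dominated because [max_cube B]
    is at least [qform B 0 = 0] and [c] is nonnegative. *)
Lemma max_cube_le (R : realType) (n : nat) (A B : 'M[R]_n) (c : R) : 0 <= c ->
  (forall b, qform A (cube_vec R b) <= qform B (cube_vec R b) + c) ->
  max_cube A <= max_cube B + c.
Proof.
move=> c0 H.
have zero (D : 'M[R]_n) : qform D 0 = 0 by rewrite /qform !mul0mx mxE.
apply/bigmax_leP; split=> [|b _].
  rewrite zero; apply: addr_ge0 => //; rewrite -(zero B).
  exact: bigmax_ge_id.
by apply: le_trans (H b) _; rewrite lerD2r; exact: (le_bigmax _ (fun b => qform B (cube_vec R b))).
Qed.

(* [s = 1] is contact from below, [s = -1] contact from above. *)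
Lemma contact_hessian (R : realType) (n : nat) (f psi : 'rV[R]_n -> R)
    (x0 p v : 'rV[R]_n) (A : 'M[R]_n) (s : R) : `|s| = 1 ->
  jet2 f x0 p A -> Ck 2 psi -> local_min (fun x => s * (f x - psi x)) x0 ->
  s * qform (hessian psi x0) v <= s * qform A v.
Proof.
move=> s1 fjet psiC2 fmin.
rewrite -subr_ge0 -mulrBr; apply/ler_addgt0Pr => e e0.
have k0 : 0 < 2 * (1 + qform 1%:M v) by rewrite mulr_gt0// ltr_pwDl// qform1_ge0.
(* The final inequality loses [2 * e' * qform 1%:M v], which this [e'] keeps below [e]. *)
have := fjet _ (divr_gt0 e0 k0); set e' := e / _ => fe.
have e'0 : 0 < e' by exact: divr_gt0.
have /nbhs_normP[r /= r0 Hr] : \forall x \near x0,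
    `|f x - f x0 - quadratic p A x0 x| <= e' * qform 1%:M (x - x0) /\
    s * (f x0 - psi x0) <= s * (f x - psi x).
  by apply: filterS2 fe fmin.
have psiC1 : Ck 1 psi.
  by case: psiC2 => c H; split=> // i; have [d [cd _]] := H i; split.
pose D y := \sum_i v 0 i * partial i psi y.
(* On the line through [x0] along [v], [f] is replaced by its Taylor polynomial, and e' t^2 |v|^2 is
   added. The result [g] lies above s (f - psi) near 0 with equality at 0, so it inherits the
   minimum and is twice differentiable at 0. *)
pose q := s * (2^-1 * bilin A v v) + e' * qform 1%:M v.
pose g (t : R) := s * (f x0 + t * bilin 1%:M p v - psi (t *: v + x0)) + t ^+ 2 * q.
pose dg (t : R) := s * (bilin 1%:M p v - D (t *: v + x0)) + (2 * t) * q.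
have dgP (t : R) : is_derive t 1 g (dg t).
  have psid : is_derive t 1 (fun t : R => psi (t *: v + x0)) (D (t *: v + x0)).
    exact/is_derive_line/is_derive_C1.
  have lin : is_derive t 1 (fun t : R => f x0 + t * bilin 1%:M p v) (bilin 1%:M p v).
    by apply: (@is_derive_second_order _ _ _ _ _ _ 0) => h; rewrite [h *: 1]mulr1; ring.
  have quad : is_derive t 1 (fun t : R => t ^+ 2 * q) (2 * t * q).
    by apply: (@is_derive_second_order _ _ _ _ _ _ q) => h; rewrite [h *: 1]mulr1; ring.
  have := is_deriveD (is_deriveZ s (is_deriveB lin psid)) quad.
  exact.
have ddg : is_derive (0 : R) 1 dg (s * (0 - qform (hessian psi x0) v) + 2 * q).
  have Dd : is_derive (0 : R) 1 (fun t : R => D (t *: v + x0)) (qform (hessian psi x0) v).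
    by apply: is_derive_line; rewrite scale0r add0r; exact: is_derive_C2.
  have quad : is_derive (0 : R) 1 (fun t : R => 2 * t * q) (2 * q).
    by apply: (@is_derive_second_order _ _ _ _ _ _ 0) => h; rewrite [h *: 1]mulr1; ring.
  have := is_deriveD (is_deriveZ s (is_deriveB
    (is_derive_cst (bilin 1%:M p v) (0 : R) 1) Dd)) quad.
  exact.
have c0 : 0 < 1 + `|v| by rewrite ltr_pwDl.
have := @second_derivative_test R g dg (r / (1 + `|v|)) _ (divr_gt0 r0 c0)
  (fun t _ => dgP t) ddg.
move=> H; apply: (le_trans (H _)).
  move=> t; rewrite ltr_pdivlMr// => tr.
  have [|j m] := Hr (t *: v + x0).
    rewrite /= opprD addrCA subrr addr0 normrN normrZ.
    by apply: le_lt_trans tr; rewrite ler_wpM2l// lerDr.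
  rewrite /g expr0n/= !mul0r scale0r add0r !addr0.
  apply: (le_trans m); rewrite addrK in j.
  have {}j : `|s * (f (t *: v + x0) - f x0 - quadratic p A x0 (t *: v + x0))| <=
     e' * (t ^+ 2 * qform 1%:M v).
    rewrite normrM s1 mul1r (le_trans j)// ler_wpM2l// ?(ltW e'0)//.
    by rewrite -![qform _ _]/(bilin _ _ _) bilinZl bilinZr; lra.
  move: j; rewrite /quadratic addrK !bilinZl !bilinZr /q ler_norml => /andP[_].
  lra.
have : e' * (2 * (1 + qform 1%:M v)) = e by rewrite /e' divfK ?gt_eqF.
rewrite /q -[qform A v]/(bilin A v v); nra.
Qed.

Lemma viscosity_solution_jet2 (R : realType) (n : nat) (phi U : 'rV[R]_n -> R) :
  continuous U ->
  (forall x0, exists p A, jet2 U x0 p A /\ U x0 = phi x0 + 2^-1 * max_cube A) ->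
  viscosity_solution phi U.
Proof.
move=> cU HU; split=> // x0 psi psiS.
have [p [A [Ujet ->]]] := HU x0.
split=> m.
  suff : max_cube (hessian psi x0) <= max_cube A + 0 by lra.
  apply: max_cube_le => // b; rewrite addr0 -[leLHS]mul1r -[leRHS]mul1r.
  apply: contact_hessian Ujet (psiS 2%N) _; first by rewrite normr1.
  by near do rewrite !mul1r.
suff : max_cube A <= max_cube (hessian psi x0) + 0 by lra.
apply: max_cube_le => // b; rewrite addr0 -lerN2 -mulN1r -[leRHS]mulN1r.
apply: contact_hessian Ujet (psiS 2%N) _; first by rewrite normrN1.
by near do rewrite !mulN1r lerN2.
Unshelve. all: by end_near. Qed.

(** * Comparison with a function that has second-order expansions *)

(** Outside a large ball the quadratic penalty beats the linear growth, so the value at 0 is already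
    larger there; inside, compactness gives a maximum. *)
Lemma coercive_max (R : realType) (n : nat) (w : 'rV[R]_n -> R) (C d : R) :
  continuous w -> (forall x, `|w x| <= C * (1 + `|x|)) -> 0 < d ->
  exists x0, forall x,
    w x - d * qform 1%:M x <= w x0 - d * qform 1%:M x0.
Proof.
move=> cw wC d0.
have C0 : 0 <= C.
  by have := wC 0; rewrite normr0 addr0 mulr1; exact: le_trans.
(* For r = |x| > M one has d r^2 >= d M r = 3 C r + d r, and 3 C r >= C (1 + r) + C since r >= 1;
   this covers the bounds on both [w x] and [w 0]. *)
pose M := 1 + 3 * C / d.
have M0 : 1 <= M by rewrite /M lerDl divr_ge0 ?mulr_ge0// ltW.
pose B := [set x : 'rV[R]_n | `|x| <= M].
pose f x := w x - d * qform 1%:M x.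
have cf : continuous f.
  have cq : continuous (fun x : 'rV[R]_n => qform 1%:M x).
    by apply: (@continuous_bilin _ _ _ _ id id) => x; exact: id.
  have cdq : continuous (fun x : 'rV[R]_n => d * qform 1%:M x).
    by move=> x; apply: continuousM (cq x); exact: cst_continuous.
  by move=> x; exact: (continuousB (cw x) (cdq x)).
have Bc : compact B.
  apply: bounded_closed_compact.
    by exists M; split=> [|y My x /= xM]; [exact: num_real|rewrite (le_trans xM)// ltW].
  have := @preimage_closed _ _ (fun x : 'rV[R]_n => `|x|) [set y | y <= M].
  by apply=> [x _|]; [exact: norm_continuous|exact: closed_le].
have B0 : B 0 by rewrite /B/= normr0 (le_trans ler01).
have [||x0 x0B Hx0] := @EVT_max_rV R n f B _ Bc.
- by exists 0.
- exact: continuous_subspaceT.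
exists x0 => x; have [xM|Mx] := leP `|x| M; first by apply: Hx0; rewrite inE.
apply: (@le_trans _ _ (f 0)); last by apply: Hx0; rewrite inE.
rewrite /f -[qform 1%:M 0]/(bilin 1%:M 0 0) -(scale0r 0) bilinZl mul0r mulr0 subr0 scale0r.
have := wC x; have := wC 0; rewrite normr0 addr0 mulr1 !ler_norml.
move=> /andP[w0 _] /andP[_ wx].
have := sqr_norm_le_qform1 x.
have : 3 * C = d * (M - 1) by rewrite /M; field; rewrite gt_eqF.
set r := `|x| in wx Mx *; set Q := qform _ x => E rQ.
have dQ : d * r ^+ 2 <= d * Q by rewrite ler_pM2l.
have r1 : 1 <= r by rewrite ltW// (le_lt_trans M0).
have : d * M * r <= d * r ^+ 2.
  by rewrite -mulrA ler_pM2l// expr2 ler_wpM2r ?(ltW Mx)// (le_trans ler01).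
have : 0 <= C * (r - 1) by rewrite mulr_ge0// subr_ge0.
have : d * M * r = 3 * C * r + d * r by rewrite E; ring.
have : 0 <= d * r by rewrite mulr_ge0 ?(ltW d0)// (le_trans ler01).
lra.
Qed.

Lemma le0_vanishing_bound (R : realType) (a b : R) :
  (forall e : R, 0 < e -> a <= e * b) -> a <= 0.
Proof.
move=> H; rewrite leNgt; apply/negP => a0.
have b0 : 0 < `|b| + 1 by rewrite ltr_wpDl.
have e0 : 0 < a / 2 / (`|b| + 1) by rewrite !divr_gt0.
have := H _ e0; have := ler_norm b.
have : a / 2 / (`|b| + 1) * (`|b| + 1) = a / 2 by rewrite divfK ?gt_eqF.
set y := _ / (_ + 1); nra.
Qed.

(* [s = 1] gives [u <= U] and [s = -1] gives [U <= u]; the linear term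
   [2 s d x0] of [psi] below re-centres [s d |x|^2] at [x0]. *)
Lemma viscosity_comparison (R : realType) (n : nat) (phi U u : 'rV[R]_n -> R)
    (s C : R) : s = 1 \/ s = -1 ->
  continuous U ->
  (forall x0, exists p A, jet2 U x0 p A /\ U x0 = phi x0 + 2^-1 * max_cube A) ->
  viscosity_solution phi u -> (forall x, `|u x - U x| <= C * (1 + `|x|)) ->
  forall x, s * (u x - U x) <= 0.
Proof.
move=> s1 cU HU [cu Hu] uC x.
have s_norm : `|s| = 1 by case: s1 => ->; rewrite ?normrN1 ?normr1.
have ss : s * s = 1 by case: s1 => ->; rewrite ?mulrNN mulr1.
apply: (@le0_vanishing_bound _ _ (n%:R + qform 1%:M x)) => d d0.
have [||x0 x0max] := @coercive_max R n (fun x => s * (u x - U x)) C d _ _ d0.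
- have cB : continuous (fun y => u y - U y).
    by move=> y; exact: (continuousB (cu y) (cU y)).
  by move=> y; apply: continuousM (cB y); exact: cst_continuous.
- by move=> y; rewrite normrM s_norm mul1r.
have [p [A [Ujet UE]]] := HU x0.
(* A bound at the maximum point suffices: passing to [x] costs at most d |x|^2, the second summand
   of the target. *)
suff wx0 : s * (u x0 - U x0) <= d * n%:R.
  have := x0max x; have := qform1_ge0 x0; nra.
apply/ler_addgt0Pr => e e0.
have e'0 : 0 < e / (n%:R + 1) by rewrite divr_gt0// ltr_wpDl.
have := Ujet _ e'0; set e' := e / _ in e'0 * => Ue.
(* The e' part absorbs the remainder of the jet of [U], the d part carries the penalty, and the
   factor 2 compensates the 1/2 in [quadratic]. *)
pose B := A + (2 * s * (e' + d)) *: 1%:M.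
pose psi := quadratic (p + (2 * s * d) *: x0) B x0.
have near_x0 : \forall y \near x0, s * (u y - psi y) <= s * (u x0 - psi x0).
  near=> y.
  have j : `|U y - U x0 - quadratic p A x0 y| <= e' * qform 1%:M (y - x0) by near: y.
  have m := x0max y.
  have psi0 : psi x0 = 0.
    rewrite /psi /quadratic subrr -(scale0r 0) !bilinZr; ring.
  have psiy : psi y = quadratic p A x0 y + 2 * s * d * bilin 1%:M x0 (y - x0)
      + s * (e' + d) * qform 1%:M (y - x0).
    rewrite /psi /quadratic bilinDl bilinZl bilinDm bilinZm -[qform _ _]/(bilin _ _ _).
    by field.
  have qy : qform 1%:M y = qform 1%:M x0 + 2 * bilin 1%:M x0 (y - x0) + qform 1%:M (y - x0).
    rewrite -[y in LHS](subrK x0) -![qform _ _]/(bilin _ _ _).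
    rewrite (bilinDl _ (y - x0) x0) !(bilinDr _ _ (y - x0) x0)
      -(bilin_tr _ x0 (y - x0)) trmx1; ring.
  have {}j : s * (U y - U x0 - quadratic p A x0 y) <= e' * qform 1%:M (y - x0).
    by rewrite (le_trans (ler_norm _))// normrM s_norm mul1r.
  have {}psiy : s * psi y = s * quadratic p A x0 y + 2 * d * bilin 1%:M x0 (y - x0)
      + (e' + d) * qform 1%:M (y - x0).
    transitivity (s * quadratic p A x0 y + (s * s) * (2 * d * bilin 1%:M x0 (y - x0))
      + (s * s) * ((e' + d) * qform 1%:M (y - x0))); first by rewrite psiy; ring.
    by rewrite ss !mul1r.
  by rewrite psi0 subr0 mulrBr psiy; move: m; rewrite qy; lra.
have qB v : qform B v = qform A v + 2 * s * (e' + d) * qform 1%:M v.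
  by rewrite -![qform _ _]/(bilin _ _ _) bilinDm bilinZm.
have e'n : e' * n%:R <= e.
  have : e' * (n%:R + 1) = e by rewrite /e' divfK// gt_eqF// ltr_wpDl.
  lra.
have ed0 : 0 <= 2 * (e' + d) * n%:R by rewrite !mulr_ge0 ?addr_ge0// ltW.
have qn (b : {ffun 'I_n -> bool}) : 0 <= qform 1%:M (cube_vec R b) <= n%:R.
  by apply/andP; split; [exact: qform1_ge0|exact: qform1_cube_le].
have psiB v : qform (hessian psi x0) v = qform B v by exact: qform_hessian_quadratic.
have [Hmin Hmax] := Hu x0 psi (smooth_quadratic _ _ _).
(* On the cube the forms of [B] and [A] differ by at most 2 (e' + d) n, which the factor 1/2 of the
   equation turns into (e' + d) n <= e + d n. *)
case: s1 => sE; move: near_x0 qB; rewrite sE => near_x0 qB.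
- have /Hmax : local_max (fun x => u x - psi x) x0.
    by move: near_x0; apply: filterS => y; rewrite !mul1r.
  have : max_cube (hessian psi x0) <= max_cube A + 2 * (e' + d) * n%:R.
    apply: max_cube_le => // b; rewrite psiB qB.
    by have /andP[? ?] := qn b; nra.
  by rewrite UE; lra.
- have /Hmin : local_min (fun x => u x - psi x) x0.
    by move: near_x0; apply: filterS => y; rewrite !mulN1r lerN2.
  have : max_cube A <= max_cube (hessian psi x0) + 2 * (e' + d) * n%:R.
    apply: max_cube_le => // b; rewrite psiB qB.
    by have /andP[? ?] := qn b; nra.
  by rewrite UE; lra.
Unshelve. all: by end_near. Qed.

(** * The explicit formula and its Taylor expansion *)

(** Continuity of the exponential at 0 bounds |exp s - 1| by e; two applications of the mean value
    inequality raise this to e |s| and then to e t^2. *)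
Lemma expR_taylor2 (R : realType) (e : R) : 0 < e ->
  exists2 d : R, 0 < d & forall t : R, `|t| < d ->
    `|expR t - 1 - t - 2^-1 * t ^+ 2| <= e * t ^+ 2.
Proof.
move=> e0.
have /cvgrPdist_le/(_ _ e0)/nbhs_normP[d /= d0 Hd] := @continuous_expR R 0.
exists d => // t td.
have small (s : R) : `|s| <= `|t| -> `|expR s - 1| <= e.
  move=> st; rewrite distrC -expR0; apply: Hd; rewrite /= sub0r normrN.
  exact: le_lt_trans td.
have dexp (s : R) : is_derive s 1 (@expR R) (expR s) by exact: is_derive_expR.
have first_order (s : R) : `|s| <= `|t| -> `|expR s - 1 - s| <= e * `|s|.
  move=> st.
  have := @MVT_norm_le R (fun u => expR u - 1 - u) (fun u => expR u - 1) e s.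
  rewrite expR0 subrr subr0 subr0; apply=> u us; last exact/small/(le_trans us).
  have d1 : is_derive u 1 (fun u : R => 1 + u) 1.
    by apply: (@is_derive_second_order _ _ _ _ _ _ 0) => h; rewrite [h *: 1]mulr1; ring.
  have -> : (fun u : R => expR u - 1 - u) = (fun u : R => expR u - (1 + u)).
    by apply/funext => y; ring.
  exact: is_deriveB (dexp u) d1.
have := @MVT_norm_le R (fun u => expR u - 1 - u - 2^-1 * u ^+ 2)
  (fun u => expR u - 1 - u) (e * `|t|) t.
rewrite expR0 subrr expr0n/= mulr0 !subr0 -mulrA -expr2 real_normK ?num_real//.
apply=> s st; last by apply: le_trans (first_order _ st) _; rewrite ler_pM2l.
have d2 : is_derive s 1 (fun u : R => 1 + u + 2^-1 * u ^+ 2) (1 + s).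
  by apply: (@is_derive_second_order _ _ _ _ _ _ 2^-1) => h; rewrite [h *: 1]mulr1; field.
have -> : (fun u : R => expR u - 1 - u - 2^-1 * u ^+ 2) =
    (fun u : R => expR u - (1 + u + 2^-1 * u ^+ 2)).
  by apply/funext => y; ring.
have -> : expR s - 1 - s = expR s - (1 + s) by ring.
exact: is_deriveB (dexp s) d2.
Qed.

(** These facts let the arithmetic below treat sqrt 2 as an opaque [k], with inverses removed. *)
Lemma sqrt2_bounds (R : realType) (k := Num.sqrt 2 : R) :
  [/\ 1 <= k, k <= 2, k * k = 2 & k^-1 = k / 2].
Proof.
have kk : k * k = 2 by rewrite -expr2 sqr_sqrtr// ler0n.
have k0 : 0 <= k by exact: sqrtr_ge0.
have k1 : 1 <= k by nra.
have kN0 : k != 0 by rewrite gt_eqF// (lt_le_trans ltr01).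
split=> //; first nra.
by apply: (mulfI kN0); rewrite divff// mulrA kk divff.
Qed.

Definition ordered_sol (R : realType) (a b c : R) : R :=
  a + (2 * Num.sqrt 2)^-1 * expR (Num.sqrt 2 * (b - a))
    + (6 * Num.sqrt 2)^-1 * expR (Num.sqrt 2 * (2 * c - b - a)).

(** The middle value is the sum minus the extremes, so symmetry follows from that of max, min and
    addition, without sorting. *)
Definition sorted_sol (R : realType) (a b c : R) : R :=
  let M := Num.max (Num.max a b) c in let m := Num.min (Num.min a b) c in
  ordered_sol M (a + b + c - M - m) m.

Lemma sorted_sol12 (R : realType) (a b c : R) :
  sorted_sol b a c = sorted_sol a b c.
Proof. by rewrite /sorted_sol (maxC b) (minC b) (addrC b). Qed.

Lemma sorted_sol23 (R : realType) (a b c : R) :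
  sorted_sol a c b = sorted_sol a b c.
Proof. by rewrite /sorted_sol (maxAC a) (minAC a) (addrAC a). Qed.

Lemma sorted_sol_ordered (R : realType) (a b c : R) : b <= a -> c <= b ->
  sorted_sol a b c = ordered_sol a b c.
Proof.
move=> ba cb; rewrite /sorted_sol (max_l ba) (max_l (le_trans cb ba)).
rewrite (min_r ba) (min_r cb); congr ordered_sol; ring.
Qed.

(** [jet_lin] and [jet_quad] are the first and second differentials of [ordered_sol] at (a, b, c),
    applied to the increment (h1, h2, h3). *)
Definition jet_lin (R : realType) (a b c h1 h2 h3 : R) : R :=
  h1 + expR (Num.sqrt 2 * (b - a)) / 2 * (h2 - h1)
     + expR (Num.sqrt 2 * (2 * c - b - a)) / 6 * (2 * h3 - h2 - h1).

Definition jet_quad (R : realType) (a b c h1 h2 h3 : R) : R :=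
  Num.sqrt 2 / 2 * expR (Num.sqrt 2 * (b - a)) * (h2 - h1) ^+ 2
  + Num.sqrt 2 / 6 * expR (Num.sqrt 2 * (2 * c - b - a)) * (2 * h3 - h2 - h1) ^+ 2.

(** Each exponential splits into its value at the base point, at most 1 by the ordering, times an
    exponential of a linear form in the increments, to which [expR_taylor2] applies. *)
Lemma ordered_sol_taylor (R : realType) (a b c e : R) :
  b <= a -> c <= b -> 0 < e ->
  exists2 d : R, 0 < d & forall h1 h2 h3 : R,
    `|h1| < d -> `|h2| < d -> `|h3| < d ->
    `|ordered_sol (a + h1) (b + h2) (c + h3) - ordered_sol a b c
      - (jet_lin a b c h1 h2 h3 + 2^-1 * jet_quad a b c h1 h2 h3)|
    <= e * (h1 ^+ 2 + h2 ^+ 2 + h3 ^+ 2).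
Proof.
move=> ba cb e0; rewrite /ordered_sol /jet_lin /jet_quad.
have [] := sqrt2_bounds R; set k := Num.sqrt 2 => k1 k2 kk ki.
have [d d0 Hd] := expR_taylor2 (divr_gt0 e0 (ltr0n R 4)).
(* Increments below d / 8 give |l1| < d / 4 and |l2| < d / 2, hence |k l| < d because k <= 2. *)
exists (d / 8) => [|h1 h2 h3 H1 H2 H3]; first exact: divr_gt0.
set l1 := h2 - h1; set l2 := 2 * h3 - h2 - h1.
have -> : k * (b + h2 - (a + h1)) = k * (b - a) + k * l1 by rewrite /l1; ring.
have -> : k * (2 * (c + h3) - (b + h2) - (a + h1)) = k * (2 * c - b - a) + k * l2.
  by rewrite /l2; ring.
rewrite !expRD.
have k0 : 0 < k by lra.
have E1 : expR (k * (b - a)) <= 1 by rewrite -[leRHS]expR0 ler_expR pmulr_rle0//; lra.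
have E2 : expR (k * (2 * c - b - a)) <= 1 by rewrite -[leRHS]expR0 ler_expR pmulr_rle0//; lra.
have := expR_ge0 (k * (b - a)); have := expR_ge0 (k * (2 * c - b - a)).
move: E1 E2; set E1 := expR (k * (b - a)); set E2 := expR (k * (2 * c - b - a)).
move=> E1_1 E2_1 E2_0 E1_0.
have small l : `|l| <= 4 * (d / 8) -> `|k * l| <= d.
  move=> ld; rewrite normrM gtr0_norm//.
  have := normr_ge0 l; nra.
have := Hd (k * l1); set r1 := _ - _ - _ - 2^-1 * _ => Hr1.
have := Hd (k * l2); set r2 := _ - _ - _ - 2^-1 * _ => Hr2.
move: H1 H2 H3; rewrite !ltr_norml => /andP[H1 H1'] /andP[H2 H2'] /andP[H3 H3'].
have {}Hr1 : `|r1| <= e / 4 * (k * l1) ^+ 2.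
  apply: Hr1; rewrite normrM (gtr0_norm k0).
  have : `|l1| < d / 4 by rewrite ltr_norml /l1; lra.
  have := normr_ge0 l1; nra.
have {}Hr2 : `|r2| <= e / 4 * (k * l2) ^+ 2.
  apply: Hr2; rewrite normrM (gtr0_norm k0).
  have : `|l2| < d / 2 by rewrite ltr_norml /l2; lra.
  have := normr_ge0 l2; nra.
have i2 : (2 * k)^-1 = k / 4 by rewrite invfM ki; field.
have i6 : (6 * k)^-1 = k / 12 by rewrite invfM ki; field.
rewrite i2 i6.
have -> : a + h1 + k / 4 * (E1 * expR (k * l1)) + k / 12 * (E2 * expR (k * l2))
    - (a + k / 4 * E1 + k / 12 * E2)
    - (h1 + E1 / 2 * l1 + E2 / 6 * l2 + 2^-1 * (k / 2 * E1 * l1 ^+ 2 + k / 6 * E2 * l2 ^+ 2))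
  = k / 4 * (E1 * r1) + k / 12 * (E2 * r2).
  have e1 : expR (k * l1) = 1 + k * l1 + 2^-1 * (k * l1) ^+ 2 + r1 by rewrite /r1; ring.
  have e2 : expR (k * l2) = 1 + k * l2 + 2^-1 * (k * l2) ^+ 2 + r2 by rewrite /r2; ring.
  have k3 : k ^+ 2 = 2 by rewrite expr2.
  rewrite e1 e2 !exprMn k3.
  (* The relation k^2 = 2 is isolated as a multiple of [k * k - 2], so that the rest is a field
     identity in a free [k]. *)
  transitivity (k / 4 * (E1 * r1) + k / 12 * (E2 * r2)
     + (k * k - 2) * (E1 / 4 * l1 + E2 / 12 * l2)); first by field.
  by rewrite kk subrr mul0r addr0.
apply: (le_trans (ler_normD _ _)).
have b1 : `|k / 4 * (E1 * r1)| <= e / 4 * (h1 ^+ 2 + h2 ^+ 2 + h3 ^+ 2) * 2.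
  rewrite !normrM (ger0_norm E1_0) (gtr0_norm k0) (gtr0_norm (_ : 0 < 4^-1)) ?invr_gt0//.
  have l1h : l1 ^+ 2 <= 2 * (h1 ^+ 2 + h2 ^+ 2 + h3 ^+ 2).
    by have := sqr_ge0 (h1 + h2); have := sqr_ge0 h3; rewrite /l1; lra.
  have : E1 * `|r1| <= e / 4 * (k * l1) ^+ 2.
    by apply: le_trans Hr1; rewrite ler_piMl.
  rewrite exprMn (expr2 k) kk.
  set X := E1 * _; set S := h1 ^+ 2 + _ + _ in l1h *.
  move=> X1; have X0 : 0 <= X by rewrite mulr_ge0.
  have : e * l1 ^+ 2 <= e * (2 * S) by rewrite ler_pM2l.
  nra.
have b2 : `|k / 12 * (E2 * r2)| <= e / 4 * (h1 ^+ 2 + h2 ^+ 2 + h3 ^+ 2) * 2.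
  rewrite !normrM (ger0_norm E2_0) (gtr0_norm k0) (gtr0_norm (_ : 0 < 12^-1)) ?invr_gt0//.
  (* Cauchy-Schwarz with the vector (-1, -1, 2), of squared norm 6; the three squares are those of
     Lagrange's identity. *)
  have l2h : l2 ^+ 2 <= 6 * (h1 ^+ 2 + h2 ^+ 2 + h3 ^+ 2).
    have := sqr_ge0 (h3 + 2 * h2); have := sqr_ge0 (h3 + 2 * h1).
    by have := sqr_ge0 (h1 - h2); rewrite /l2; lra.
  have : E2 * `|r2| <= e / 4 * (k * l2) ^+ 2.
    by apply: le_trans Hr2; rewrite ler_piMl.
  rewrite exprMn (expr2 k) kk.
  set X := E2 * _; set S := h1 ^+ 2 + _ + _ in l2h *.
  move=> X1; have X0 : 0 <= X by rewrite mulr_ge0.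
  have : e * l2 ^+ 2 <= e * (6 * S) by rewrite ler_pM2l.
  nra.
lra.
Qed.

(** On the wall a = b the first exponential is 1, and the linear terms in h1 and h2 average. *)
Lemma jet12 (R : realType) (a c h1 h2 h3 : R) :
  jet_lin a a c h2 h1 h3 = jet_lin a a c h1 h2 h3 /\
  jet_quad a a c h2 h1 h3 = jet_quad a a c h1 h2 h3.
Proof. by rewrite /jet_lin /jet_quad subrr mulr0 expR0; split; field. Qed.

(** On the wall b = c the two exponentials coincide, and their weights 1/2 and 1/6 combine
    symmetrically in h2 and h3. *)
Lemma jet23 (R : realType) (a b h1 h2 h3 : R) :
  jet_lin a b b h1 h3 h2 = jet_lin a b b h1 h2 h3 /\
  jet_quad a b b h1 h3 h2 = jet_quad a b b h1 h2 h3.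
Proof.
rewrite /jet_lin /jet_quad.
have -> : 2 * b - b - a = b - a by ring.
by split; field.
Qed.

Lemma gap (R : realType) (a b : R) : b <= a -> exists2 d : R, 0 < d &
  forall h1 h2, `|h1| < d -> `|h2| < d -> a + h1 < b + h2 -> a = b.
Proof.
rewrite le_eqVlt => /orP[/eqP ->|ba]; first by exists 1.
exists ((a - b) / 2) => [|h1 h2]; first by rewrite divr_gt0// subr_gt0.
by rewrite !ltr_norml => /andP[? ?] /andP[? ?]; lra.
Qed.

(* A nearby point whose coordinates are ordered differently forces the
   corresponding coordinates of [(a, b, c)] to coincide, and then the 2-jet is
   invariant under exchanging them. *)
Lemma sorted_sol_taylor (R : realType) (a b c e : R) :
  b <= a -> c <= b -> 0 < e ->
  exists2 d : R, 0 < d & forall h1 h2 h3 : R,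
    `|h1| < d -> `|h2| < d -> `|h3| < d ->
    `|sorted_sol (a + h1) (b + h2) (c + h3) - sorted_sol a b c
      - (jet_lin a b c h1 h2 h3 + 2^-1 * jet_quad a b c h1 h2 h3)|
    <= e * (h1 ^+ 2 + h2 ^+ 2 + h3 ^+ 2).
Proof.
move=> ba cb e0; rewrite (sorted_sol_ordered ba cb).
have [d d0 Hd] := ordered_sol_taylor ba cb e0.
have [g1 g10 G1] := gap ba; have [g2 g20 G2] := gap cb.
exists (Num.min d (Num.min g1 g2)) => [|h1 h2 h3]; first by rewrite !lt_min d0 g10 g20.
rewrite !lt_min => /and3P[d1 g11 g21] /and3P[d2 g12 g22] /and3P[d3 g13 g23].
pose P h1 h2 h3 := `|sorted_sol (a + h1) (b + h2) (c + h3) - ordered_sol a b c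
      - (jet_lin a b c h1 h2 h3 + 2^-1 * jet_quad a b c h1 h2 h3)|
    <= e * (h1 ^+ 2 + h2 ^+ 2 + h3 ^+ 2).
have ord h1' h2' h3' : `|h1'| < d -> `|h2'| < d -> `|h3'| < d ->
    b + h2' <= a + h1' -> c + h3' <= b + h2' -> P h1' h2' h3'.
  by move=> D1 D2 D3 q1 q2; rewrite /P sorted_sol_ordered//; exact: Hd.
have swap12 x y z : a = b -> P y x z -> P x y z.
  rewrite /P => <-; have [-> ->] := jet12 a c x y z.
  by rewrite sorted_sol12 (addrC (y ^+ 2)).
have swap23 x y z : b = c -> P x z y -> P x y z.
  rewrite /P => <-; have [-> ->] := jet23 a b x y z.
  by rewrite sorted_sol23 (addrAC (x ^+ 2)).
rewrite -/(P h1 h2 h3).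
(* The perturbed triple is sorted by adjacent swaps, each justified by an equality obtained from
   [gap]. *)
case: (leP (b + h2) (a + h1)) => q1;
  case: (leP (c + h3) (b + h2)) => q2.
- exact: ord.
- have bc := G2 _ _ g22 g23 q2; apply: (swap23 _ _ _ bc).
  case: (leP (b + h3) (a + h1)) => q3; first by apply: ord => //; lra.
  have ab := G1 _ _ g11 g13 q3; apply: (swap12 _ _ _ ab).
  by apply: ord => //; lra.
- have ab := G1 _ _ g11 g12 q1; apply: (swap12 _ _ _ ab).
  case: (leP (c + h3) (b + h1)) => q3; first by apply: ord => //; lra.
  have bc := G2 _ _ g21 g23 q3; apply: (swap23 _ _ _ bc).
  by apply: ord => //; lra.
- have ab := G1 _ _ g11 g12 q1; have bc := G2 _ _ g22 g23 q2.
  apply: (swap12 _ _ _ ab); apply: (swap23 _ _ _ bc); apply: (swap12 _ _ _ ab).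
  by apply: ord => //; lra.
Qed.

(** * Permutations of the three coordinates *)

(** Adjacent transpositions generate the symmetric group, so a symmetric identity is checked on the
    identity and two swaps. *)
Lemma ord3_perm_ind (P : 'I_3 -> 'I_3 -> 'I_3 -> Prop) : P 0 1 2 ->
  (forall i j l, P i j l -> P j i l) -> (forall i j l, P i j l -> P i l j) ->
  forall i j l, uniq [:: i; j; l] -> P i j l.
Proof.
move=> P0 P12 P23.
have ordE (i : 'I_3) : [\/ i = 0, i = 1 | i = 2].
  case: i => [[|[|[|//]]] ilt]; [exact/Or31/val_inj|exact/Or32/val_inj|].
  exact/Or33/val_inj.
move=> i j l; case: (ordE i) => ->; case: (ordE j) => ->; case: (ordE l) => -> // _.
- exact: (P23 _ _ _).
- exact: (P12 _ _ _).
- by apply: (P23 _ _ _); apply: (P12 _ _ _).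
- by apply: (P12 _ _ _); apply: (P23 _ _ _).
- by apply: (P12 _ _ _); apply: (P23 _ _ _); apply: (P12 _ _ _).
Qed.

Lemma ord3_decreasing (R : realType) (x : 'rV[R]_3) : exists i j l : 'I_3,
  [/\ uniq [:: i; j; l], x 0 j <= x 0 i & x 0 l <= x 0 j].
Proof.
case: (leP (x 0 1) (x 0 0)) => [|/ltW] h1; case: (leP (x 0 2) (x 0 1)) => [|/ltW] h2;
  case: (leP (x 0 2) (x 0 0)) => [|/ltW] h3.
- by exists 0, 1, 2.
- by exists 0, 1, 2.
- by exists 0, 2, 1.
- by exists 2, 0, 1.
- by exists 1, 0, 2.
- by exists 1, 2, 0.
- by exists 2, 1, 0.
- by exists 2, 1, 0.
Qed.

Definition sol (R : realType) (x : 'rV[R]_3) : R :=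
  sorted_sol (x 0 0) (x 0 1) (x 0 2).

Lemma sol_perm (R : realType) (x : 'rV[R]_3) (i j l : 'I_3) :
  uniq [:: i; j; l] -> sorted_sol (x 0 i) (x 0 j) (x 0 l) = sol x.
Proof.
move: i j l; apply: ord3_perm_ind => // i j l <-; first exact: sorted_sol12.
exact: sorted_sol23.
Qed.

Lemma max3_perm (R : realType) (x : 'rV[R]_3) (i j l : 'I_3) :
  uniq [:: i; j; l] -> Num.max (Num.max (x 0 i) (x 0 j)) (x 0 l) = max3 x.
Proof.
move: i j l; apply: ord3_perm_ind => // i j l <-; first by rewrite (maxC (x 0 i)).
exact: maxAC.
Qed.

Lemma sum3_perm (R : realType) (F : 'I_3 -> R) (i j l : 'I_3) :
  uniq [:: i; j; l] -> F i + F j + F l = \sum_k F k.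
Proof.
move: i j l; apply: ord3_perm_ind => [|i j l <-|i j l <-]; [|ring|ring].
by rewrite !big_ord_recl big_ord0 addr0 addrA; congr (_ + F _ + F _); exact: val_inj.
Qed.

Lemma symmetric_sol (R : realType) : symmetric_fun (@sol R).
Proof.
move=> s x; rewrite /sol !mxE; apply: sol_perm.
by rewrite /= !inE !(inj_eq perm_inj).
Qed.

(** * The equation for the explicit solution, and uniqueness *)

Lemma bilin1_delta (R : realType) (n : nat) (i : 'I_n) (h : 'rV[R]_n) :
  bilin 1%:M (delta_mx 0 i) h = h 0 i.
Proof. by rewrite /bilin mulmx1 -rowE !mxE. Qed.

Lemma bilin_rank1 (R : realType) (n : nat) (w h : 'rV[R]_n) :
  bilin (w^T *m w) h h = bilin 1%:M w h ^+ 2.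
Proof.
rewrite /bilin mulmx1 mulmxA -mulmxA mxE big_ord1 expr2; congr (_ * _).
by rewrite -[h in LHS]trmxK -trmx_mul mxE.
Qed.

(** With i, j, l in decreasing order of coordinates, the Hessian is a nonnegative combination of two
    rank-one matrices. Half its value k/2 E1 + k/6 E2 at the i-th basis vector is exactly the sum of
    the exponential terms. *)
Lemma sol_jet2 (R : realType) (x0 : 'rV[R]_3) : exists p A,
  jet2 (@sol R) x0 p A /\ sol x0 = max3 x0 + 2^-1 * max_cube A.
Proof.
have [i [j [l [ijl ji lj]]]] := ord3_decreasing x0.
have [] := sqrt2_bounds R; set k := Num.sqrt 2 => k1 k2 kk ki.
have k0 : 0 < k by lra.
pose E1 := expR (k * (x0 0 j - x0 0 i)).
pose E2 := expR (k * (2 * x0 0 l - x0 0 j - x0 0 i)).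
pose w1 : 'rV[R]_3 := delta_mx 0 j + (-1) *: delta_mx 0 i.
pose w2 : 'rV[R]_3 := 2 *: delta_mx 0 l + (-1) *: delta_mx 0 j + (-1) *: delta_mx 0 i.
pose p : 'rV[R]_3 := delta_mx 0 i + (E1 / 2) *: w1 + (E2 / 6) *: w2.
pose A := (k / 2 * E1) *: (w1^T *m w1) + (k / 6 * E2) *: (w2^T *m w2).
have w1E h : bilin 1%:M w1 h = h 0 j - h 0 i.
  by rewrite bilinDl bilinZl !bilin1_delta mulN1r.
have w2E h : bilin 1%:M w2 h = 2 * h 0 l - h 0 j - h 0 i.
  by rewrite !bilinDl !bilinZl !bilin1_delta !mulN1r.
have pE h : bilin 1%:M p h = jet_lin (x0 0 i) (x0 0 j) (x0 0 l) (h 0 i) (h 0 j) (h 0 l).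
  by rewrite !bilinDl !(bilinZl _ (_ / _)) w1E w2E bilin1_delta.
have AE h : bilin A h h = jet_quad (x0 0 i) (x0 0 j) (x0 0 l) (h 0 i) (h 0 j) (h 0 l).
  by rewrite bilinDm !bilinZm !bilin_rank1 w1E w2E.
exists p, A; split.
  move=> e e0; have [d d0 Hd] := sorted_sol_taylor ji lj e0.
  near=> x.
  have xd : `|x0 - x| < d.
    by near: x; have := nbhsx_ballx x0 d d0; rewrite -ball_normE.
  have coord a : `|(x - x0) 0 a| < d.
    by apply: le_lt_trans xd; rewrite distrC norm_coord_le.
  have := Hd _ _ _ (coord i) (coord j) (coord l).
  rewrite -pE -AE -[bilin _ p _ + _]/(quadratic p A x0 x).
  rewrite -[qform _ _]/(bilin _ _ _) bilin1E -(sum3_perm _ ijl) -!expr2.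
  have xE a : x0 0 a + (x - x0) 0 a = x 0 a by rewrite !mxE; ring.
  by rewrite !xE !sol_perm.
(* This is where x_l <= x_j enters: the vertices e_l and e_i + e_j both give 2k/3 E2, which must not
   exceed k/2 E1 + k/6 E2. *)
have E12 : E2 <= E1 by rewrite ler_expR ler_pM2l//; lra.
have E2_0 : 0 <= E2 by exact: expR_ge0.
have kE2 : 0 <= k * E2 by rewrite mulr_ge0// ltW.
have kE1 : 0 <= k * (E1 - E2) by rewrite mulr_ge0 ?subr_ge0// ltW.
have -> : max_cube A = k / 2 * E1 + k / 6 * E2.
  apply/eqP; rewrite eq_le; apply/andP; split.
    apply/bigmax_leP; split=> [|b _].
      by rewrite /qform !mul0mx mxE; lra.
    rewrite -[qform _ _]/(bilin _ _ _) AE /jet_quad !mxE -/k -/E1 -/E2.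
    by case: (b i); case: (b j); case: (b l); rewrite /=; lra.
  have := le_bigmax (qform A 0) (fun b => qform A (cube_vec R b)) [ffun a => a == i].
  apply: le_trans; rewrite -[qform _ _]/(bilin _ _ _) AE /jet_quad !mxE !ffunE -/k -/E1 -/E2.
  move: ijl; rewrite /= !inE negb_or => /and3P[/andP[ij il] jl _].
  by rewrite eqxx eq_sym (negPf ij) eq_sym (negPf il) /=; lra.
rewrite -(sol_perm _ ijl) sorted_sol_ordered// /ordered_sol -/k -/E1 -/E2.
rewrite -(max3_perm _ ijl) (max_l ji) (max_l (le_trans lj ji)) !invfM ki; lra.
Unshelve. all: by end_near. Qed.

Lemma jet2_continuous (R : realType) (n : nat) (f : 'rV[R]_n -> R)
    (x0 p : 'rV[R]_n) (A : 'M[R]_n) :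
  jet2 f x0 p A -> {for x0, continuous f}.
Proof.
move=> fjet; apply: (@cvgrPdist_le _ _ _ _ (nbhs_filter x0) f (f x0)).2 => e e0.
have e20 : 0 < e / 2 by rewrite divr_gt0.
have near_quadratic q B : \forall x \near x0, `|quadratic q B x0 x| <= e / 2.
  have /cvgrPdist_le/(_ _ e20) := @continuous_quadratic R n q B x0 x0.
  apply: filterS => x; have -> : quadratic q B x0 x0 = 0.
    by rewrite /quadratic subrr -(scale0r 0) !bilinZr; ring.
  by rewrite sub0r normrN.
near=> x.
have j : `|f x - f x0 - quadratic p A x0 x| <= 1 * qform 1%:M (x - x0).
  by near: x; exact: fjet.
have q1 : `|quadratic p A x0 x| <= e / 2 by near: x; exact: near_quadratic.
have q2 : `|quadratic 0 (2 *: 1%:M) x0 x| <= e / 2 by near: x; exact: near_quadratic.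
(* The squared distance is itself a quadratic function vanishing at [x0], hence small nearby. *)
have qE : qform 1%:M (x - x0) = quadratic 0 (2 *: 1%:M) x0 x.
  rewrite /quadratic -[X in bilin 1%:M X](scale0r 0) bilinZl bilinZm.
  by rewrite -[qform _ _]/(bilin _ _ _); field.
by move: j q1 q2; rewrite qE mul1r distrC !ler_norml; lra.
Unshelve. all: by end_near. Qed.

(** In the ordered chamber the two exponential terms are at most 1/2 and 1/6, so their sum stays
    below 1. *)
Lemma linear_growth_sol (R : realType) : linear_growth (@sol R).
Proof.
exists 1 => x; have [i [j [l [ijl ji lj]]]] := ord3_decreasing x.
rewrite -(sol_perm _ ijl) sorted_sol_ordered// /ordered_sol.
have [] := sqrt2_bounds R; set k := Num.sqrt 2 => k1 k2 kk ki.
have k0 : 0 < k by lra.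
have E1 : expR (k * (x 0 j - x 0 i)) <= 1.
  by rewrite -[leRHS]expR0 ler_expR pmulr_rle0//; lra.
have E2 : expR (k * (2 * x 0 l - x 0 j - x 0 i)) <= 1.
  by rewrite -[leRHS]expR0 ler_expR pmulr_rle0//; lra.
have xi := norm_coord_le x i.
have := expR_ge0 (k * (x 0 j - x 0 i)).
have := expR_ge0 (k * (2 * x 0 l - x 0 j - x 0 i)).
move: E1 E2; set E1 := expR _; set E2 := expR _ => E1_1 E2_1 E2_0 E1_0.
have : `|(2 * k)^-1 * E1| <= 2^-1.
  by rewrite invfM ki ger0_norm; nra.
have : `|(6 * k)^-1 * E2| <= 6^-1.
  by rewrite invfM ki ger0_norm; nra.
have := ler_normD (x 0 i + (2 * k)^-1 * E1) ((6 * k)^-1 * E2).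
have := ler_normD (x 0 i) ((2 * k)^-1 * E1).
lra.
Qed.

Lemma viscosity_solution_sol (R : realType) : viscosity_solution (@max3 R) (@sol R).
Proof.
apply: viscosity_solution_jet2 => [x|]; last exact: sol_jet2.
by have [p [A [/jet2_continuous]]] := sol_jet2 x.
Qed.

Lemma viscosity_solution_unique (R : realType) (u : 'rV[R]_3 -> R) :
  viscosity_solution (@max3 R) u -> linear_growth u -> u = @sol R.
Proof.
move=> uv [C uC]; have [D solD] := linear_growth_sol R.
have [csol _] := viscosity_solution_sol R.
have growth x : `|u x - sol x| <= (C + D) * (1 + `|x|).
  by rewrite mulrDl (le_trans (ler_normB _ _))// lerD.
apply/funext => x; apply/eqP; rewrite eq_le -subr_le0 -(subr_ge0 (sol x)) -oppr_le0.
have := viscosity_comparison (or_introl erefl) csol (@sol_jet2 R) uv growth x.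
have := viscosity_comparison (or_intror erefl) csol (@sol_jet2 R) uv growth x.
by rewrite mul1r mulN1r => -> ->.
Qed.

Unset Implicit Arguments.

Theorem theorem8 (R : realType) :
  (exists! u : 'rV[R]_3 -> R,
     viscosity_solution (@max3 R) u /\ linear_growth u) /\
  (forall u : 'rV[R]_3 -> R,
     viscosity_solution (@max3 R) u -> linear_growth u ->
     symmetric_fun u /\
     (forall x : 'rV[R]_3,
        x 0 1 <= x 0 0 -> x 0 2 <= x 0 1 ->
        u x = x 0 0
              + (2 * Num.sqrt 2)^-1 * expR (Num.sqrt 2 * (x 0 1 - x 0 0))
              + (6 * Num.sqrt 2)^-1
                * expR (Num.sqrt 2 * (2 * x 0 2 - x 0 1 - x 0 0)))).
Proof.
split.
  exists (@sol R); split.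
    by split; [exact: viscosity_solution_sol|exact: linear_growth_sol].
  by move=> u [uv ug]; rewrite (viscosity_solution_unique uv ug).
move=> u uv ug; rewrite (viscosity_solution_unique uv ug); split.
  exact: symmetric_sol.
by move=> x x10 x21; rewrite /sol sorted_sol_ordered.
Qed.
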